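(* Let $P$ be a bidirectional path of order $n\ge 2$ on vertices $v_1,\dots,v_n$ with endpoints $v_1,v_n$: there are edges from $v_i$ to $v_{i+1}$ and from $v_{i+1}$ to $v_i$ for all $1\le i\le n-1$, and no other edges. Denote by $l_i>0$ the weight on the edge from $v_{i-1}$ to $v_i$ and by $r_i>0$ the weight on the edge from $v_{i+1}$ to $v_i$. Then $$\operatorname{ept}_{\mathrm{rzf}}(P,v_1)=\sum_{i=2}^{n-1}\frac{l_i+r_i}{l_i}+1\qquad\text{and}\qquad \operatorname{ept}_{\mathrm{rzf}}(P,v_n)=\sum_{i=2}^{n-1}\frac{l_i+r_i}{r_i}+1.$$
   Context: Randomized zero forcing (RZF): $G$ is a finite directed graph with nonnegative weights $w_{uv}$ on directed edges $(u,v)$, with $w_{uv}=0$ if there is no edge from $u$ to $v$. Start with blue set $B_0=S$. Given the blue set $B_t$, each white vertex $w\notin B_t$ independently becomes blue at round $t+1$ with probability $p_t(w)=\frac{\sum_{u\in B_t}w_{uw}}{\sum_{u\in V(G)}w_{uw}}$ if the denominator is positive, and $p_t(w)=0$ otherwise; blue vertices stay blue forever. Expected propagation time: if it is possible (with positive probability) to color all of $G$ blue starting from $S$, then $\operatorname{ept}_{\mathrm{rzf}}(G,S)$ is the expected value of $\tau=\min\{t: B_t=V(G)\}$; otherwise it is $\infty$. $\operatorname{ept}_{\mathrm{rzf}}(G,v)$ means $\operatorname{ept}_{\mathrm{rzf}}(G,\{v\})$. *)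

(* Defs.v *)
From HB Require Import structures.
From mathcomp Require Import all_boot all_order all_algebra.
From mathcomp Require Import all_classical all_reals all_analysis.
Set Implicit Arguments.
Unset Strict Implicit.
Unset Printing Implicit Defensive.
Import Order.TTheory GRing.Theory Num.Theory.
Local Open Scope ring_scope.
Local Open Scope classical_set_scope.

Record wdigraph (R : realType) (V : finType) := WDigraph {
  edge : rel V;
  weight : V -> V -> R;
  weight_ge0 : forall u v, 0 <= weight u v;
  weight_nonedge : forall u v, ~~ edge u v -> weight u v = 0 }.

Section Rzf.
Context {R : realType} {V : finType} (G : wdigraph R V).

Definition blue_prob (A : {set V}) (v : V) : R :=
  if 0 < \sum_u weight G u v
  then (\sum_(u in A) weight G u v) / (\sum_u weight G u v)
  else 0.

(* Probability that one round turns the blue set A into C: blue vertices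
   stay blue, white vertices decide independently of each other. *)
Definition rzf_trans (A C : {set V}) : R :=
  \prod_v (if v \in A then (v \in C)%:R
           else if v \in C then blue_prob A v
           else 1 - blue_prob A v).

(* B is a realization, on the probability space (T, Pr), of randomized zero
   forcing on G from S.  The last field says that, conditionally on any
   history A 0, ..., A t of positive probability, the next blue set is C with
   probability rzf_trans (A t) C; it determines the law of B. *)
Record rzf_process (d : measure_display) (T : measurableType d)
    (Pr : probability T R) (S : {set V}) (B : nat -> T -> {set V}) : Prop :=
  RzfProcess {
  rzf_measurable : forall t A, measurable [set x | B t x = A];
  rzf_start : Pr [set x | B 0%N x = S] = 1%E;
  rzf_step : forall (t : nat) (A : nat -> {set V}) (C : {set V}),
    Pr [set x | (forall s, (s <= t)%N -> B s x = A s) /\ B t.+1 x = C]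
    = (Pr [set x | forall s, (s <= t)%N -> B s x = A s]
       * (rzf_trans (A t) C)%:E)%E }.

End Rzf.

Section Ept.
Context {R : realType} {V : finType}.
Context {d : measure_display} {T : measurableType d}.

(* Equal to +oo when the graph is never entirely blue. *)
Definition propagation_time (B : nat -> T -> {set V}) (x : T) : \bar R :=
  ereal_inf [set t%:R%:E | t in [set t : nat | B t x = [set: V]%SET]].

Definition ept (Pr : probability T R) (B : nat -> T -> {set V}) : \bar R :=
  if `[< (0 < Pr [set x | exists t, B t x = [set: V]%SET])%E >]
  then (\int[Pr]_x propagation_time B x)%E
  else +oo%E.

End Ept.

(* The vertex v_i of the path is the ordinal i - 1. *)
Definition bidirectional_path (R : realType) (n : nat)
    (P : wdigraph R 'I_n) : Prop :=
  forall u v : 'I_n,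
    edge P u v = (val v == (val u).+1) || (val u == (val v).+1).

(* Main.v *)
(* Started at an end of a path, the blue set always consists of the vertices on
   one side of a front, and only the next vertex v beyond the front can change
   colour, which it does with some fixed probability q v in each round.  Give
   every vertex v the cost c v = 1 / q v and let H A be the total cost of the
   vertices that are white when A is blue.  One round lowers the expectation of
   H by exactly the probability that the graph is not yet blue.  Hence these
   probabilities sum to H S minus the limit of E[H(B_t)]; being summable they
   tend to 0, and so does E[H(B_t)], because H is bounded and vanishes on the
   full vertex set V.  Since V is absorbing, the sum of P(B_t <> V) over all t
   is the expected propagation time. *)

Require Import Defs.
From HB Require Import structures.
From mathcomp Require Import all_boot all_order all_algebra.
From mathcomp Require Import all_classical all_reals all_analysis.
From mathcomp Require Import measurable_realfun ring zify.
Set Implicit Arguments.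
Unset Strict Implicit.
Unset Printing Implicit Defensive.
Import Order.TTheory GRing.Theory Num.Theory.
Import numFieldNormedType.Exports.
Local Open Scope ring_scope.

(** * Finite partitions and hitting times *)

Lemma mem_bigsetU (T : Type) (I : finType) (P : pred I) (F : I -> set T) (x : T) :
  (\big[setU/set0]_(i | P i) F i)%classic x <-> exists2 i, P i & F i x.
Proof.
rewrite -bigcup_seq_cond; split=> [[i /= /andP[_ Pi] Fi]|[i Pi Fi]].
  by exists i.
by exists i => //=; rewrite mem_index_enum.
Qed.

(** Total probability over a finite-valued map. It is used to split an event by the present blue
    set, by the next one, or by a whole finite history. *)
Lemma measure_fibers (d : measure_display) (T : measurableType d) (R : realType)
    (mu : {measure set T -> \bar R}) (F : finType) (f : T -> F) (E : set T) :
  (forall a, measurable [set x | f x = a]%classic) -> measurable E ->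
  mu E = (\sum_a mu (E `&` [set x | f x = a])%classic)%E.
Proof.
move=> mf mE.
pose G (i : 'I_#|F|) := (E `&` [set x | f x = enum_val i])%classic.
have -> : E = \big[setU/set0]_(i < #|F|) G i.
  apply/seteqP; split=> x /=; last by case/mem_bigsetU => i _ [].
  move=> Ex; apply/mem_bigsetU; exists (enum_rank (f x)) => //.
  by rewrite /G /= ?enum_rankK.
rewrite measure_bigsetU_ord.
- rewrite [RHS](reindex (@enum_val F predT))/=; last first.
    by apply: onW_bij; exact: enum_val_bij.
  apply: eq_bigr => i _; congr (mu _); apply/seteqP; split=> x /=.
    by case=> Ex fx; split => //; apply/mem_bigsetU; exists i.
  by case=> /mem_bigsetU[j _ [Ex _]] fx.
- by move=> i; apply: measurableI.
- apply/trivIsetP => i j _ _ ij; rewrite -subset0 => x [[_ /= fi] [_ /= fj]].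
  by move: ij; rewrite -(inj_eq enum_val_inj) -fi fj eqxx.
Qed.

(** Tail-sum formula: a first hitting time [m] counts the indices [t < m], which are exactly those
    where [P] has failed up to and including [t]. If [P] never holds, both sides are [+oo]. *)
Lemma ereal_inf_natE (R : realType) (P : pred nat) :
  ereal_inf [set t%:R%:E | t in [set t : nat | P t]]%classic =
  (\sum_(0 <= t <oo)
     (`[< forall s, (s <= t)%N -> ~~ P s >]%:R : R)%:E)%E.
Proof.
have ge0 t : (0 <= (`[< forall s, (s <= t)%N -> ~~ P s >]%:R : R)%:E)%E.
  by rewrite lee_fin.
have [exP|nP] := pselect (exists t, P t).
  pose m := ex_minn exP; have [Pm mmin] : P m /\ forall k, P k -> (m <= k)%N.
    by rewrite /m; case: ex_minnP.
  rewrite (nneseries_split 0 m)// add0n [X in (_ + X)%E]eseries0 ?adde0; last first.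
    by move=> t mt _; case: asboolP => // /(_ m mt); rewrite Pm.
  rewrite (eq_big_nat _ _ (F2 := fun=> 1%:E)); last first.
    move=> t /andP[_ tm]; rewrite asboolT// => s st.
    by apply: contraL tm => /mmin ms; rewrite -leqNgt (leq_trans ms).
  rewrite sumEFin sumr_const_nat subn0.
  apply/eqP; rewrite eq_le; apply/andP; split.
    by apply: ereal_inf_lbound; exists m.
  by apply: le_ereal_inf_tmp => _ [k /= Pk <-]; rewrite lee_fin ler_nat mmin.
rewrite (_ : [set t | P t]%classic = set0) ?image_set0 ?ereal_inf0; last first.
  by rewrite -subset0 => t Pt; apply: nP; exists t.
(* Every term is 1, so the partial sum of length [Num.bound |r|] already exceeds [r]. *)
apply/esym/eq_infty => r; apply: (@le_trans _ _ (Num.bound `|r|)%:R%:E).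
  by rewrite lee_fin (le_trans (ler_norm _))// ltW// archi_boundP.
apply: le_trans (nneseries_lim_ge (Num.bound `|r|) _) => //.
rewrite (eq_big_nat _ _ (F2 := fun=> 1%:E)); last first.
  by move=> t _; rewrite asboolT// => s _; apply/negP => Ps; apply: nP; exists s.
by rewrite sumEFin sumr_const_nat subn0.
Qed.

(** * The law of the blue set *)

Section Law.
Context (R : realType) (V : finType) (G : wdigraph R V).
Context (d : measure_display) (T : measurableType d) (Pr : probability T R).
Context (S : {set V}) (B : nat -> T -> {set V}) (BP : rzf_process G Pr S B).
Local Open Scope classical_set_scope.

Lemma measurable_history (P : {set V} -> bool) t :
  measurable [set x | forall s, (s <= t)%N -> P (B s x)].
Proof.
have -> : [set x | forall s, (s <= t)%N -> P (B s x)] =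
    \bigcap_(s in `I_t.+1) \big[setU/set0]_(A | P A) [set x | B s x = A].
  apply/seteqP; split=> x /= h s st.
    by apply/mem_bigsetU; exists (B s x) => //; exact: h.
  by case/mem_bigsetU: (h s st) => A PA /= ->.
apply: fin_bigcap_measurable => // s _.
by apply: bigsetU_measurable => A _; exact: (rzf_measurable BP).
Qed.

Lemma measurable_blue (P : {set V} -> bool) t :
  measurable [set x | P (B t x)].
Proof.
have -> : [set x | P (B t x)] = \big[setU/set0]_(A | P A) [set x | B t x = A].
  apply/seteqP; split=> x /=.
    by move=> h; apply/mem_bigsetU; exists (B t x).
  by case/mem_bigsetU => A PA /= ->.
by apply: bigsetU_measurable => A _; exact: (rzf_measurable BP).
Qed.

(** Markov property for the present state alone: [rzf_step] conditions on a full history, and its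
    transition factor depends only on the last entry, so one can sum over all histories ending in
    [A]. *)
Lemma rzf_step_marginal t (A C : {set V}) :
  Pr [set x | B t x = A /\ B t.+1 x = C] =
  (Pr [set x | B t x = A] * (rzf_trans G A C)%:E)%E.
Proof.
(* Packing the history up to time [t] into a finite function gives it finitely many values;
   [inord t] is the index of the last entry. *)
pose f x := [ffun i : 'I_t.+1 => B i x].
have fE a : [set x | f x = a] =
    [set x | forall s, (s <= t)%N -> B s x = a (inord s)].
  apply/seteqP; split=> x /=; first by move=> <- s st; rewrite ffunE inordK.
  by move=> h; apply/ffunP => i; rewrite ffunE h ?inord_val// -ltnS.
have mf a : measurable [set x | f x = a].
  have -> : [set x | f x = a] =
      \bigcap_(i in [set: 'I_t.+1]) [set x | B i x = a i].
    apply/seteqP; split=> x /=; first by move=> <- i _; rewrite /= ffunE.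
    by move=> h; apply/ffunP => i; rewrite ffunE h.
  apply: fin_bigcap_measurable => [|i _]; first exact: finite_finset.
  exact: (rzf_measurable BP).
have mA := rzf_measurable BP t A.
rewrite [in RHS](measure_fibers Pr mf mA) (measure_fibers Pr mf); last first.
  exact: measurableI (rzf_measurable BP _ _).
rewrite ge0_sume_distrl//; apply: eq_bigr => a _.
(* A history whose last entry differs from [A] contributes 0 to both sums. *)
have [aA|aA] := eqVneq (a (inord t)) A; last first.
  have e E : E `<=` [set x | B t x = A] -> E `&` [set x | f x = a] = set0.
    move=> EA; rewrite fE -subset0 => x [/EA /= Bx /(_ t (leqnn t)) Bx'].
    by move: aA; rewrite -Bx' Bx eqxx.
  by rewrite !e// ?measure0 ?mul0e// => x [].
rewrite -aA; have := rzf_step BP t (fun s => a (inord s)) C; rewrite -fE.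
have -> : [set x | B t x = a (inord t)] `&` [set x | f x = a] =
    [set x | f x = a].
  by apply/setIidr => x; rewrite /= -/([set x | f x = a] x) fE; exact.
move=> <-; congr (Pr _); apply/seteqP; split=> x /=.
  case=> -[_ BC] fa; split=> //.
  by move: fa; rewrite -/([set x | f x = a] x) fE.
case=> fa BC; have : [set x | f x = a] x by rewrite fE.
by move=> /= ->; split => //; split => //; exact: fa.
Qed.

Definition law t A : R := fine (Pr [set x | B t x = A]).

Lemma law_ge0 t A : 0 <= law t A.
Proof. exact: fine_ge0. Qed.

Lemma lawE t A : Pr [set x | B t x = A] = (law t A)%:E.
Proof. by rewrite fineK// fin_num_measure//; exact: (rzf_measurable BP). Qed.

Lemma prob_blue (P : pred {set V}) t :
  Pr [set x | P (B t x)] = (\sum_(A | P A) law t A)%:E.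
Proof.
rewrite (measure_fibers Pr (rzf_measurable BP t) (measurable_blue P t)).
rewrite -sumEFin [RHS]big_mkcond/=; apply: eq_bigr => A _; case: ifPn => PA.
  by rewrite -lawE; congr (Pr _); apply/setIidr => x /= ->.
rewrite (_ : _ `&` _ = set0) ?measure0// -subset0 => x /= [+ BA].
by rewrite BA (negPf PA).
Qed.

Lemma law_sum1 t : \sum_A law t A = 1.
Proof.
apply: EFin_inj; rewrite -prob_blue -(probability_setT Pr).
by congr (Pr _); apply/seteqP.
Qed.

Lemma law_start A : law 0 A = (A == S)%:R.
Proof.
have lS : law 0 S = 1 by rewrite /law (rzf_start BP).
have [->//|AS] := eqVneq A S.
(* [S] already carries the total mass 1, so nothing is left for another set. *)
apply/eqP; rewrite eq_le law_ge0 andbT.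
have := law_sum1 0; rewrite (bigD1 S)//= lS (bigD1 A)//= => /esym/eqP.
rewrite addrC -subr_eq subrr mulr0n => /eqP ->.
by rewrite lerDl; apply: sumr_ge0 => C _; exact: law_ge0.
Qed.

Lemma law_step t C : law t.+1 C = \sum_A law t A * rzf_trans G A C.
Proof.
apply: EFin_inj; rewrite -lawE -sumEFin.
rewrite (measure_fibers Pr (rzf_measurable BP t) (rzf_measurable BP t.+1 C)).
apply: eq_bigr => A _; rewrite EFinM -lawE -rzf_step_marginal.
by congr (Pr _); apply/seteqP; split=> x /= [].
Qed.

Lemma rzf_trans_mono (A C : {set V}) : ~~ (A \subset C) -> rzf_trans G A C = 0.
Proof.
by case/subsetPn => v vA vC; rewrite /rzf_trans (bigD1 v)//= vA (negPf vC) mul0r.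
Qed.

(** The fields of [rzf_process] make the blue set grow only almost surely, so the two events may
    differ. The difference is a null set because leaving the full set has probability 0. This turns
    the tail event of the propagation time into a statement about one time. *)
Lemma prob_not_full_before t :
  Pr [set x | forall s, (s <= t)%N -> B s x != [set: V]%SET] =
  Pr [set x | B t x != [set: V]%SET].
Proof.
pose E u := [set x | forall s, (s <= u)%N -> B s x != [set: V]%SET].
pose N u := [set x | B u x != [set: V]%SET].
have mE u : measurable (E u) := measurable_history (fun A => A != [set: V]%SET) u.
have mN u : measurable (N u) := measurable_blue (fun A => A != [set: V]%SET) u.
have EN u : E u `<=` N u by move=> x; exact.
suff NE0 : Pr (N t `\` E t) = 0%E.
  apply/eqP; rewrite eq_le; apply/andP; split.
    by apply: le_measure; rewrite ?inE//; [exact: mE|exact: mN|exact: EN].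
  rewrite -/(N t) -/(E t) -(setDUK (@EN t)).
  have /le_trans := measureU2 Pr (mE t) (measurableD (mN t) (mE t)); apply.
  by rewrite [X in (_ + X <= _)%E]NE0 adde0.
elim: t => [|t IH].
  rewrite (_ : _ `\` _ = set0) ?measure0// -subset0 => x [Nx]; apply=> s.
  by rewrite leqn0 => /eqP ->.
pose F := [set x | B t x = [set: V]%SET /\ B t.+1 x != [set: V]%SET].
have mF : measurable F by exact: measurableI (rzf_measurable BP _ _) (mN t.+1).
have full0 : Pr F = 0%E.
  rewrite (measure_fibers Pr (rzf_measurable BP t.+1) mF).
  apply: big1 => C _; have [CV|CV] := eqVneq C [set: V]%SET.
    rewrite (_ : _ `&` _ = set0) ?measure0// -subset0 => x /= [[_ +] BC].
    by rewrite BC CV eqxx.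
  have -> : F `&` [set x | B t.+1 x = C] =
      [set x | B t x = [set: V]%SET /\ B t.+1 x = C].
    apply/seteqP; split=> x /=; first by case=> -[].
    by case=> BT BC; split; rewrite // /F /= BC.
  apply: etrans (rzf_step_marginal _ _ _) _.
  by rewrite rzf_trans_mono ?mule0// finset.subTset.
apply/eqP; rewrite eq_le measure_ge0 andbT -[leRHS]adde0.
rewrite -[X in (_ <= X + _)%E]IH -[X in (_ <= _ + X)%E]full0.
apply: le_trans (measureU2 Pr (measurableD (mN t) (mE t)) mF).
apply: le_measure; rewrite ?inE.
- exact: measurableD.
- by apply: measurableU => //; exact: measurableD.
(* A path white somewhere at time [t.+1] but full earlier was either full at time [t], hence in [F],
   or already exceptional at time [t]. *)
- move=> x [Nx Ex]; have [Bx|Bx] := eqVneq (B t x) [set: V]%SET; first by right.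
  left; split=> // Etx; apply: Ex => s; rewrite leq_eqVlt => /orP[/eqP ->//|].
  by rewrite ltnS; exact: Etx.
Qed.
End Law.

(** * Graphs whose blue set grows through a single vertex at a time *)

Section Frontier.
Context (R : realType) (V : finType) (G : wdigraph R V) (A : {set V}) (v : V).
Context (vA : v \notin A)
  (white0 : forall w, w \notin A -> w != v -> blue_prob G A w = 0).

(** A set missing a vertex of [A] would need a blue vertex to revert; one with a new vertex other
    than [v] contains a factor [blue_prob] equal to 0. Only [A] and [v |: A] remain. *)
Lemma rzf_trans_frontier0 (C : {set V}) :
  C != A -> C != (v |: A)%SET -> rzf_trans G A C = 0.
Proof.
move=> CA CvA; have [AC|] := boolP (A \subset C); last exact: rzf_trans_mono.
have [CvA'|] := boolP (C \subset v |: A)%SET; last first.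
  case/subsetPn => w wC; rewrite finset.in_setU1 negb_or => /andP[wv wA].
  by rewrite /rzf_trans (bigD1 w)//= (negPf wA) wC white0// mul0r.
have [vC|vC] := boolP (v \in C).
  case/eqP: CvA; apply/eqP.
  by rewrite finset.eqEsubset CvA' finset.subUset finset.sub1set vC.
case/eqP: CA; apply/eqP; rewrite finset.eqEsubset AC andbT.
apply/fintype.subsetP => w wC.
move/fintype.subsetP: CvA' => /(_ w wC); rewrite finset.in_setU1.
by case/orP => // /eqP wv; rewrite -wv wC in vC.
Qed.

Lemma rzf_trans_frontier_stay : rzf_trans G A A = 1 - blue_prob G A v.
Proof.
rewrite /rzf_trans (bigD1 v)//= (negPf vA) big1 ?mulr1// => w wv.
by case: ifPn => [->|wA]; rewrite ?(negPf wA) ?white0// subr0.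
Qed.

Lemma rzf_trans_frontier_move : rzf_trans G A (v |: A)%SET = blue_prob G A v.
Proof.
rewrite /rzf_trans (bigD1 v)//= (negPf vA) finset.setU11 big1 ?mulr1// => w wv.
rewrite finset.in_setU1 (negPf wv) /=.
by case: ifPn => [->|wA]; rewrite ?(negPf wA) ?white0// subr0.
Qed.

Lemma rzf_trans_frontier_sum (F : {set V} -> R) :
  \sum_C rzf_trans G A C * F C =
  blue_prob G A v * F (v |: A)%SET + (1 - blue_prob G A v) * F A.
Proof.
have vAA : (v |: A)%SET != A.
  by apply: contraNneq vA => <-; rewrite finset.setU11.
rewrite (bigD1 (v |: A)%SET)//= (bigD1 A) 1?eq_sym//= big1 ?addr0.
  by rewrite rzf_trans_frontier_stay rzf_trans_frontier_move.
by move=> C /andP[CvA CA]; rewrite rzf_trans_frontier0 ?mul0r.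
Qed.
End Frontier.

(** * Drift of the remaining cost and the expected propagation time *)

Section SingleFrontier.
Context (R : realType) (V : finType) (G : wdigraph R V).
(** [Q] is an invariant family of blue sets: adding the frontier vertex stays inside it. Writing the
    cost as [blue_prob G A v * c v = 1] also forces the frontier probability to be nonzero, and to
    be the same for every set of [Q] with frontier [v]. *)
Context (Q : {set V} -> Prop) (c : V -> R) (c_ge0 : forall v, 0 <= c v).
Context (frontier : forall A, Q A -> A != [set: V]%SET -> exists v,
  [/\ v \notin A, blue_prob G A v * c v = 1,
      forall w, w \notin A -> w != v -> blue_prob G A w = 0 & Q (v |: A)%SET]).
Local Open Scope classical_set_scope.

Let H (A : {set V}) := \sum_(v | v \notin A) c v.

(** With probability [blue_prob G A v] the cost falls by [c v], and otherwise it is unchanged, so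
    the mean drop is their product 1. The full set is absorbing and has cost 0. *)
Lemma cost_drift A : Q A ->
  \sum_C rzf_trans G A C * H C = H A - (A != [set: V]%SET)%:R.
Proof.
move=> QA; have [->|AT] := eqVneq A [set: V]%SET.
  have HT : H [set: V]%SET = 0 by rewrite /H big1// => v; rewrite inE.
  rewrite HT subr0 big1// => C _; have [->|CT] := eqVneq C [set: V]%SET.
    by rewrite HT mulr0.
  by rewrite rzf_trans_mono ?mul0r// finset.subTset.
have [v [vA cv wA _]] := frontier QA AT.
rewrite (rzf_trans_frontier_sum vA wA).
have -> : H A = c v + H (v |: A)%SET.
  rewrite /H (bigD1 v)//=; congr (_ + _); apply: eq_bigl => w.
  by rewrite finset.in_setU1 negb_or andbC.
rewrite mulrBl mul1r mulrDr cv /=; ring.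
Qed.

Context (d : measure_display) (T : measurableType d) (Pr : probability T R).
Context (S : {set V}) (B : nat -> T -> {set V}).
Context (BP : rzf_process G Pr S B) (QS : Q S).

(** Induction on time: a transition of positive probability either stays put or adds the frontier
    vertex, and both preserve [Q]. Thus [cost_drift] applies to every set that the process
    charges. *)
Lemma law_reachable t A : law Pr B t A != 0 -> Q A.
Proof.
elim: t A => [|t IH] C.
  by rewrite (law_start BP); case: (eqVneq C S) => [->//|_]; rewrite eqxx.
rewrite (law_step BP) => /negP nz.
have [A lA tA] : exists2 A, law Pr B t A != 0 & rzf_trans G A C != 0.
  apply: contra_notP nz => nA; rewrite big1// => A _.
  apply/eqP; rewrite mulf_eq0; apply/negPn; rewrite negb_or; apply/negP.
  by case/andP => lA tA; apply: nA; exists A.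
have QA := IH A lA.
have [AT|AT] := eqVneq A [set: V]%SET.
  have : A \subset C by apply: contraNT tA => /rzf_trans_mono ->.
  by rewrite AT finset.subTset => /eqP ->; rewrite -AT.
have [v [vA cv wA QvA]] := frontier QA AT.
have [->//|CA] := eqVneq C A.
have [->//|CvA] := eqVneq C (v |: A)%SET.
by rewrite (rzf_trans_frontier0 wA CA CvA) eqxx in tA.
Qed.

Let u t := \sum_(A | A != [set: V]%SET) law Pr B t A.

Lemma series_not_full : series u @ \oo --> H S.
Proof.
pose E t := \sum_A law Pr B t A * H A.
have H_ge0 A : 0 <= H A by apply: sumr_ge0.
have u_ge0 t : 0 <= u t by apply: sumr_ge0 => A _; exact: law_ge0.
have E_ge0 t : 0 <= E t.
  by apply: sumr_ge0 => A _; rewrite mulr_ge0// law_ge0.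
have ES t : E t.+1 = E t - u t.
  rewrite /E; under eq_bigr do rewrite (law_step BP) mulr_suml.
  rewrite exchange_big/= [u t]big_mkcond/= -sumrB; apply: eq_bigr => A _.
  under eq_bigr do rewrite -mulrA.
  rewrite -mulr_sumr; have [->|lA] := eqVneq (law Pr B t A) 0.
    by rewrite !mul0r if_same subr0.
  rewrite (cost_drift (law_reachable lA)) mulrBr; congr (_ - _).
  by case: ifP => _; rewrite ?mulr1 ?mulr0.
(* The drift identity telescopes, starting from [E 0 = H S]. *)
have sE t : series u t = H S - E t.
  elim: t => [|t IH]; last by rewrite seriesSr IH ES; ring.
  rewrite /series/= big_geq// /E (bigD1 S)//= big1 ?addr0.
    by rewrite (law_start BP) eqxx mul1r subrr.
  by move=> A /negPf AS; rewrite (law_start BP) AS mul0r.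
have cu : cvgn (series u).
  apply: nondecreasing_is_cvgn; first exact: nondecreasing_series.
  by exists (H S) => _ [t _ <-]; rewrite sE gerBl.
have u0 := cvg_series_cvg_0 cu.
rewrite (_ : series u = fun t => H S - E t); last by apply/funext.
rewrite -[X in _ --> X]subr0; apply: cvgB; first exact: cvg_cst.
(* The cost is at most [H] of the empty set and vanishes on the full set, so its mean is controlled
   by the probability [u t] of not being full; hence it tends to 0 with [u]. *)
have Eu t : E t <= H finset.set0 * u t.
  rewrite /u mulr_sumr [leRHS]big_mkcond; apply: ler_sum => A _.
  case: ifPn => AT.
    rewrite mulrC ler_wpM2r ?law_ge0//.
    rewrite /H [leRHS](bigID (fun v => v \notin A))/=.
    rewrite [X in _ <= X + _](eq_bigl (fun v => v \notin A)).
      by rewrite lerDl sumr_ge0.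
    by move=> v; rewrite inE.
  move/negPn/eqP: AT => ->.
  by rewrite /H [X in _ * X]big1 ?mulr0// => v; rewrite inE.
apply: (@squeeze_cvgr _ _ _ _ (cst 0) (fun t => H finset.set0 * u t)).
- by apply: nearW => t; rewrite /= E_ge0 Eu.
- exact: cvg_cst.
- by rewrite -[X in _ --> X](mulr0 (H finset.set0)); apply: cvgMr.
Qed.

Lemma ept_single_frontier : ept Pr B = (\sum_(v | v \notin S) c v)%:E.
Proof.
have mF t := measurable_history BP (fun A => A != [set: V]%SET) t.
have mE : measurable [set x | exists t, B t x = [set: V]%SET].
  rewrite (_ : [set _ | _] = \bigcup_t [set x | B t x = [set: V]%SET]).
    by apply: bigcupT_measurable => t; exact: (rzf_measurable BP).
  by apply/seteqP; split=> x /= [t]; exists t.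
have u0 : u @ \oo --> (0 : R).
  apply: cvg_series_cvg_0; apply/cvg_ex; exists (H S).
  exact: series_not_full.
(* This selects the finite branch of [ept]: once [u t < 1], the full set has positive probability at
   time [t]. *)
have pos : (0 < Pr [set x | exists t, B t x = [set: V]%SET])%E.
  have [t ut] : exists t, u t < 1.
    have /cvgr_lt/(_ 1 ltr01)[t _ ut] := u0.
    by exists t; exact: ut (leqnn t).
  apply: (@lt_le_trans _ _ (Pr [set x | B t x = [set: V]%SET])).
    rewrite (lawE BP) lte_fin.
    have := law_sum1 BP t; rewrite (bigD1 [set: V]%SET)//= -/(u t) => e.
    by rewrite -(ltrD2r (u t)) add0r e.
  apply: le_measure; rewrite ?inE//; first exact: (rzf_measurable BP).
  by move=> x Bx; exists t.
rewrite /ept asboolT//.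
(* The propagation time is a series of nonnegative indicators, so integral and sum may be
   exchanged. *)
transitivity (\int[Pr]_x \sum_(0 <= t <oo)
    (\1_[set x | forall s, (s <= t)%N -> B s x != [set: V]%SET] x)%:E)%E.
  apply: eq_integral => x _; rewrite /propagation_time.
  rewrite -[RHS](_ :
      ereal_inf [set t%:R%:E | t in [set t | B t x == [set: V]%SET]] = _).
    by congr ereal_inf; congr image; apply/seteqP; split=> t /eqP.
  by rewrite ereal_inf_natE; apply: eq_eseriesr => t _; rewrite indicE.
rewrite integral_nneseries//; last first.
  by move=> t; apply/measurable_EFinP; exact: measurable_indic.
rewrite (eq_eseriesr (g := fun t => (u t)%:E)); last first.
  move=> t _; rewrite integral_indic// setIT.
  apply: etrans (prob_not_full_before BP t) _.
  exact: prob_blue BP (fun A => A != [set: V]%SET) t.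
apply: cvg_lim => //.
rewrite (_ : (fun n => _) = EFin \o series u).
  by apply: cvg_comp series_not_full _.
by apply/funext => n /=; rewrite sumEFin.
Qed.
End SingleFrontier.

(* When the total weight is 0 the right-hand side is 0 / 0 = 0. *)
Lemma blue_probE (R : realType) (V : finType) (G : wdigraph R V)
    (A : {set V}) (v : V) :
  blue_prob G A v = (\sum_(u in A) weight G u v) / \sum_u weight G u v.
Proof.
rewrite /blue_prob; case: ltrP => // le0.
have -> : \sum_u weight G u v = 0.
  by apply/eqP; rewrite eq_le le0 sumr_ge0// => u _; exact: weight_ge0.
by rewrite invr0 mulr0.
Qed.

(** * Bidirectional paths *)

Section Path.
Context (R : realType) (n : nat) (P : wdigraph R 'I_n) (hP : bidirectional_path P).

(** Sums over all vertices on one side have at most one nonzero term, the weight from the neighbour,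
    and are 0 at an end of the path. This gives one cost formula for inner vertices and endpoints
    alike. *)
Let left (v : 'I_n) := \sum_(u : 'I_n | (u < v)%N) weight P u v.
Let right (v : 'I_n) := \sum_(u : 'I_n | (v < u)%N) weight P u v.

Lemma path_weight0 (u v : 'I_n) :
  v != u.+1 :> nat -> u != v.+1 :> nat -> weight P u v = 0.
Proof. by move=> vu uv; rewrite weight_nonedge// hP negb_or; apply/andP. Qed.

Lemma path_left (u v : 'I_n) : v = u.+1 :> nat -> left v = weight P u v.
Proof.
move=> vu; rewrite /left (bigD1 u)/= ?vu// big1 ?addr0// => w /andP[wv wu].
by apply: path_weight0; move: wu; rewrite -(inj_eq val_inj)/=; lia.
Qed.

Lemma path_right (u v : 'I_n) : u = v.+1 :> nat -> right v = weight P u v.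
Proof.
move=> uv; rewrite /right (bigD1 u)/= ?uv// big1 ?addr0// => w /andP[wv wu].
by apply: path_weight0; move: wu; rewrite -(inj_eq val_inj)/=; lia.
Qed.

Lemma path_right_last (v : 'I_n) : v.+1 = n -> right v = 0.
Proof. by move=> vn; rewrite /right big1// => u; have := ltn_ord u; lia. Qed.

Lemma path_left_first (v : 'I_n) : v = 0%N :> nat -> left v = 0.
Proof. by move=> v0; rewrite /left big1// => u; lia. Qed.

Lemma path_in_weight v : \sum_u weight P u v = left v + right v.
Proof.
rewrite (bigID (fun u : 'I_n => (u < v)%N))/=; congr (_ + _).
rewrite (bigD1 v) ?ltnn//= path_weight0 ?add0r; try lia.
by apply: eq_bigl => u; rewrite -(inj_eq val_inj)/=; lia.
Qed.

Lemma left_ge0 v : 0 <= left v.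
Proof. by apply: sumr_ge0 => u _; exact: weight_ge0. Qed.

Lemma right_ge0 v : 0 <= right v.
Proof. by apply: sumr_ge0 => u _; exact: weight_ge0. Qed.

Context (d : measure_display) (T : measurableType d) (Pr : probability T R).
Context (B : nat -> T -> {set 'I_n}).

Lemma ept_path_first (v1 : 'I_n) (hv1 : v1 = 0%N :> nat) :
  (forall v : 'I_n, (0 < v)%N -> 0 < left v) ->
  rzf_process P Pr [set v1]%SET B ->
  ept Pr B = (\sum_(v : 'I_n | v != v1) (left v + right v) / left v)%:E.
Proof.
move=> left_gt0 BP.
(* The blue sets are nonempty initial segments with frontier vertex [k]; [0 < k] provides its left
   neighbour, so that [left] is positive there. *)
pose Q (A : {set 'I_n}) :=
  exists2 k, (0 < k)%N & A = [set u : 'I_n | (u < k)%N]%SET.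
rewrite (@ept_single_frontier _ _ P Q
  (fun v => (left v + right v) / left v) _ _ _ _ _ _ _ BP).
- by congr EFin; apply: eq_bigl => v; rewrite inE.
- by move=> v; rewrite divr_ge0 ?addr_ge0 ?left_ge0 ?right_ge0.
- move=> _ [k k0 ->] AT; have kn : (k < n)%N.
    rewrite ltnNge; apply: contra AT => nk; apply/eqP/setP => u; rewrite !inE.
    by have := ltn_ord u; lia.
  exists (Ordinal kn); split.
  + by rewrite inE ltnn.
  (* The blue vertices are those left of the frontier, so its success probability is
     [left / (left + right)], the inverse of the cost. *)
  + have lk := left_gt0 (Ordinal kn) k0.
    rewrite blue_probE path_in_weight; under eq_bigl do rewrite inE.
    rewrite -/(left (Ordinal kn)) mulrA divfK ?divff ?lt0r_neq0//.
    by rewrite ltr_wpDr ?right_ge0.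
  (* A white vertex past [k] is at distance at least 2 from every blue vertex. *)
  + move=> w; rewrite inE -(inj_eq val_inj)/= => wk wk'.
    rewrite blue_probE big1 ?mul0r// => u; rewrite inE => uk.
    by apply: path_weight0; lia.
  + exists k.+1 => //; apply/setP => u; rewrite !inE -(inj_eq val_inj)/=.
    by rewrite ltnS [RHS]leq_eqVlt.
- by exists 1%N => //; apply/setP => u; rewrite !inE -(inj_eq val_inj)/= hv1; lia.
Qed.

Lemma ept_path_last (vn : 'I_n) (hvn : vn = n.-1 :> nat) :
  (forall v : 'I_n, (v < n.-1)%N -> 0 < right v) ->
  rzf_process P Pr [set vn]%SET B ->
  ept Pr B = (\sum_(v : 'I_n | v != vn) (left v + right v) / right v)%:E.
Proof.
move=> right_gt0 BP.
pose Q (A : {set 'I_n}) :=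
  exists2 k, (k < n)%N & A = [set u : 'I_n | (k <= u)%N]%SET.
rewrite (@ept_single_frontier _ _ P Q
  (fun v => (left v + right v) / right v) _ _ _ _ _ _ _ BP).
- by congr EFin; apply: eq_bigl => v; rewrite inE.
- by move=> v; rewrite divr_ge0 ?addr_ge0 ?left_ge0 ?right_ge0.
(* A final segment starting at 0 is everything. One starting at [k.+1] has frontier [k], and
   [k.+1 < n] provides its right neighbour. *)
- move=> _ [[|k] kn ->] AT.
    by case/eqP: AT; apply/setP => u; rewrite !inE.
  have kn' : (k < n)%N := ltnW kn.
  exists (Ordinal kn'); split.
  + by rewrite inE ltnn.
  + have rk : 0 < right (Ordinal kn') by apply: right_gt0; rewrite /=; lia.
    rewrite blue_probE path_in_weight; under eq_bigl do rewrite inE.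
    rewrite -/(right (Ordinal kn')) mulrA divfK ?divff ?lt0r_neq0//.
    by rewrite ltr_wpDl ?left_ge0.
  + move=> w; rewrite inE -(inj_eq val_inj)/= => wk wk'.
    rewrite blue_probE big1 ?mul0r// => u; rewrite inE => uk.
    by apply: path_weight0; lia.
  + exists k => //; apply/setP => u; rewrite !inE -(inj_eq val_inj)/=.
    by rewrite [RHS]leq_eqVlt eq_sym.
- exists n.-1; first by have := ltn_ord vn; lia.
  apply/setP => u; rewrite !inE -(inj_eq val_inj)/= hvn.
  by have := ltn_ord u; lia.
Qed.
End Path.

(** * Rewriting the two cost sums with the weights [l] and [r] *)

Theorem theorem3p1 (R : realType) (n : nat) (hn : (2 <= n)%N)
    (P : wdigraph R 'I_n) (hP : bidirectional_path P)
    (l r : nat -> R)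
    (hl : forall i : nat, (2 <= i <= n)%N -> 0 < l i)
    (hr : forall i : nat, (1 <= i <= n.-1)%N -> 0 < r i)
    (hwl : forall u v : 'I_n,
      val v = (val u).+1 -> weight P u v = l (val v).+1)
    (hwr : forall u v : 'I_n,
      val u = (val v).+1 -> weight P u v = r (val v).+1)
    (v1 vn : 'I_n) (hv1 : val v1 = 0%N) (hvn : val vn = n.-1) :
  (forall (d : measure_display) (T : measurableType d)
      (Pr : probability T R) (B : nat -> T -> {set 'I_n}),
    rzf_process P Pr [set v1]%SET B ->
    ept Pr B = (\sum_(2 <= i < n) ((l i + r i) / l i) + 1)%:E) /\
  (forall (d : measure_display) (T : measurableType d)
      (Pr : probability T R) (B : nat -> T -> {set 'I_n}),
    rzf_process P Pr [set vn]%SET B ->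
    ept Pr B = (\sum_(2 <= i < n) ((l i + r i) / r i) + 1)%:E).
Proof.
pose left (v : 'I_n) := \sum_(u : 'I_n | (u < v)%N) weight P u v.
pose right (v : 'I_n) := \sum_(u : 'I_n | (v < u)%N) weight P u v.
have leftE (v : 'I_n) : (0 < v)%N -> left v = l v.+1.
  move=> v0; have vn' := ltn_ord v; have un : (v.-1 < n)%N by lia.
  have vu : v = (Ordinal un).+1 :> nat by rewrite /=; lia.
  by rewrite /left (path_left hP vu) hwl.
have rightE (v : 'I_n) : (v < n.-1)%N -> right v = r v.+1.
  move=> vn'; have un : (v.+1 < n)%N by lia.
  have uv : Ordinal un = v.+1 :> nat by [].
  by rewrite /right (path_right hP uv) hwr.
have left_gt0 (v : 'I_n) : (0 < v)%N -> 0 < left v.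
  by move=> v0; rewrite leftE// hl//; have := ltn_ord v; lia.
have right_gt0 (v : 'I_n) : (v < n.-1)%N -> 0 < right v.
  by move=> v0; rewrite rightE// hr//; lia.
split=> d T Pr B BP.
- rewrite (ept_path_first hP hv1 left_gt0 BP); congr EFin.
  (* Vertex [v] carries the index [v.+1]. At [i = n] the value [r n] is unconstrained, but the true
     right weight is 0, so the cost is [left / left = 1]: this is the summand 1 of the formula. *)
  pose f i : R := if (i < n)%N then (l i + r i) / l i else 1.
  transitivity (\sum_(i < n | i != 0%N :> nat) f i.+1).
    apply: eq_big => v; first by rewrite -(inj_eq val_inj)/= hv1.
    rewrite -(inj_eq val_inj)/= hv1 => v0; rewrite -/(left v) -/(right v) /f.
    case: ltnP => vn'; first by rewrite leftE ?rightE//; lia.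
    rewrite /right path_right_last; last by have := ltn_ord v; lia.
    by rewrite addr0 divff// lt0r_neq0// left_gt0// lt0n.
  rewrite big_mkcond.
  rewrite -(big_mkord xpredT (fun i => if i != 0%N then f i.+1 else 0)).
  rewrite big_ltn ?(ltnW hn)//= add0r (eq_big_nat _ _ (F2 := fun i => f i.+1)).
    rewrite -(big_add1 _ _ 1 n.+1 xpredT f) big_nat_recr//= {2}/f ltnn.
    by congr (_ + _); apply: eq_big_nat => i /andP[_ ni]; rewrite /f ni.
  by case.
- rewrite (ept_path_last hP hvn right_gt0 BP); congr EFin.
  (* Mirror image: the far endpoint now has index 1, where [left] is 0 and the cost is 1, while
     [l 1] is unconstrained. *)
  pose f i : R := if (1 < i)%N then (l i + r i) / r i else 1.
  transitivity (\sum_(i < n | i != n.-1 :> nat) f i.+1).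
    apply: eq_big => v; first by rewrite -(inj_eq val_inj)/= hvn.
    rewrite -(inj_eq val_inj)/= hvn => v0; rewrite -/(left v) -/(right v) /f.
    have vn' : (v < n.-1)%N by have := ltn_ord v; lia.
    case: ltnP => v0'; first by rewrite leftE ?rightE.
    rewrite /left path_left_first; last by lia.
    by rewrite add0r divff// lt0r_neq0// right_gt0.
  rewrite big_mkcond.
  rewrite -(big_mkord xpredT (fun i => if i != n.-1 then f i.+1 else 0)).
  rewrite -{1}(prednK (ltnW hn)) big_nat_recr//= eqxx addr0.
  rewrite (eq_big_nat _ _ (F2 := fun i => f i.+1)); last first.
    by move=> i /andP[_ /ltn_eqF ->].
  rewrite -(big_add1 _ _ 0 n xpredT f) big_ltn//= addrC {2}/f ltnn.
  by congr (_ + _); apply: eq_big_nat => i /andP[i2 _]; rewrite /f i2.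
Qed.
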